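(* Let $\mathcal G=(\mathcal V,\mathcal E)$ be an ordered LFF graph on $\{1,\dots,n\}$ and let $(\mathcal G,\mathbf g)$ be a target bearing formation, $\mathbf g=(\mathbf g_{ij})_{ij\in\mathcal E}$ with $\mathbf g_{ij}\in\mathbb S^{d-1}$, that satisfies Assumption 2. Then for almost all initial conditions the solution $p(t)=(p_1(t),\dots,p_n(t))$ of the bearing-only formation control system $$\dot p_i(t)=-\sum_{j:\,ij\in\mathcal E}P_{g_{ij}(t)}\mathbf g_{ij},\qquad i=1,\dots,n,$$ satisfies $\lim_{t\to\infty}p(t)=\mathrm p$ for a configuration $\mathrm p\in F_B^{-1}(\mathbf g)$, and the convergence rate is exponential.
   Context: Agents have positions $p_i(t)\in\mathbb R^d$ (typically $d\in\{2,3\}$). An edge $ij\in\mathcal E$ is directed from $i$ to $j$. The bearing is $g_{ij}=\frac{p_j-p_i}{\|p_j-p_i\|}\in\mathbb S^{d-1}$, with $g_{ij}(t)$ its value along the trajectory; for $x\neq0$, $P_x=I_d-\frac{xx^T}{\|x\|^2}$. The bearing function $F_B$ maps a configuration $p\in\mathbb R^{dn}$ to the stacked vector of bearings $g_{ij}$, $ij\in\mathcal E$. Ordered LFF (leader-first follower) graph: a directed graph such that (i) vertex $1$ (the leader) has no outgoing edges; (ii) vertex $2$ (the first follower) has exactly one outgoing edge, pointing to vertex $1$; (iii) every vertex $i\ge 3$ has at least two outgoing edges, all pointing to vertices with indices smaller than $i$. Assumption 2: $(\mathcal G,\mathbf g)$ is realizable (i.e. $F_B^{-1}(\mathbf g)\ne\emptyset$),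 and there exists a configuration $\mathrm p\in F_B^{-1}(\mathbf g)$ such that for every $i$ and any distinct $j,k\in\mathcal N_i=\{j: ij\in\mathcal E\}$ the points $\mathrm p_i,\mathrm p_j,\mathrm p_k$ are not collinear. Standing assumption: no inter-agent collisions occur, so that all bearings are well defined along trajectories.
   Formalization: The dimension is assumed to satisfy d ≥ 2: for d = 1 and n = 2 all projections P vanish, agents never move, and half of the initial conditions keep the wrong bearing (for d = 1, n ≥ 3 Assumption 2 cannot hold). *)

(* Defs.v *)
From HB Require Import structures.
From mathcomp Require Import all_boot all_order all_algebra.
From mathcomp Require Import all_classical all_reals all_analysis.

Set Implicit Arguments.
Unset Strict Implicit.
Unset Printing Implicit Defensive.

Import Order.TTheory GRing.Theory Num.Theory.
Import numFieldNormedType.Exports.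

Local Open Scope classical_set_scope.
Local Open Scope ring_scope.

(* A configuration of n agents in R^d is a matrix p : 'M[R]_(d, n) whose      *)
(* column [col i p] is the position of agent i.  Agents are numbered from 0,  *)
(* so the leader is agent 0 and the first follower is agent 1.                *)

(* The library norm `|_| on matrices is the sup norm, hence this definition.  *)
Definition enorm (R : realType) (m n : nat) (A : 'M[R]_(m, n)) : R :=
  Num.sqrt (\sum_(i < m) \sum_(j < n) A i j ^+ 2).

Definition proj_orth (R : realType) (d : nat) (x : 'cV[R]_d) : 'M[R]_d :=
  1%:M - (enorm x ^- 2) *: (x *m x^T).

Definition bearing (R : realType) (d n : nat) (p : 'M[R]_(d, n)) (i j : 'I_n)
  : 'cV[R]_d :=
  (enorm (col j p - col i p))^-1 *: (col j p - col i p).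

(* [E i j] means that there is an edge directed from i to j.                  *)
Definition bearings_defined (R : realType) (d n : nat) (E : rel 'I_n)
    (p : 'M[R]_(d, n)) : Prop :=
  forall i j : 'I_n, E i j -> col i p != col j p.

(* The preimage F_B^-1(g) of a family g of bearings; only the values of g on  *)
(* edges matter.                                                              *)
Definition bearing_preimage (R : realType) (d n : nat) (E : rel 'I_n)
    (g : 'I_n -> 'I_n -> 'cV[R]_d) : set 'M[R]_(d, n) :=
  [set p | bearings_defined E p /\
           forall i j : 'I_n, E i j -> bearing p i j = g i j].

Definition ordered_LFF (n : nat) (E : rel 'I_n) : Prop :=
  [/\ (1 < n)%N,
      forall i j : 'I_n, i = 0%N :> nat -> ~~ E i j,
      forall i j : 'I_n, i = 1%N :> nat -> E i j = (j == 0%N :> nat) &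
      forall i : 'I_n, (2 <= i)%N ->
        (2 <= #|[set j | E i j]%SET|)%N /\
        (forall j : 'I_n, E i j -> (j < i)%N)].

Definition collinear (R : realType) (d : nat) (x y z : 'cV[R]_d) : Prop :=
  exists (a v : 'cV[R]_d) (r s t : R),
    [/\ x = a + r *: v, y = a + s *: v & z = a + t *: v].

Definition noncollinear_realizable (R : realType) (d n : nat) (E : rel 'I_n)
    (g : 'I_n -> 'I_n -> 'cV[R]_d) : Prop :=
  exists2 p : 'M[R]_(d, n), bearing_preimage E g p &
    forall i j k : 'I_n, E i j -> E i k -> j != k ->
      ~ collinear (col i p) (col j p) (col k p).

(* Lebesgue-null sets of R^(m * n), identified with m x n matrices: sets that *)
(* can be covered by countably many boxes of arbitrarily small total volume.  *)
Definition lebesgue_null (R : realType) (m n : nat) (N : set 'M[R]_(m, n))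
  : Prop :=
  forall eps : R, 0 < eps ->
    exists a b : nat -> 'M[R]_(m, n),
      [/\ forall k i j, a k i j <= b k i j,
          N `<=` \bigcup_k [set x | forall i j, a k i j <= x i j <= b k i j] &
          (\sum_(0 <= k <oo) (\prod_(i < m) \prod_(j < n) (b k i j - a k i j))%:E
             <= eps%:E)%E].

Definition control_field (R : realType) (d n : nat) (E : rel 'I_n)
    (g : 'I_n -> 'I_n -> 'cV[R]_d) (p : 'M[R]_(d, n)) (i : 'I_n) : 'cV[R]_d :=
  - \sum_(j < n | E i j) proj_orth (bearing p i j) *m g i j.

(* Solutions on [0, +oo[ along which every bearing stays well defined: p is   *)
(* continuous on [0, +oo[ and satisfies the differential equation on          *)
(* ]0, +oo[; its values at negative times are irrelevant.                     *)
Definition formation_solution (R : realType) (d n : nat) (E : rel 'I_n)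
    (g : 'I_n -> 'I_n -> 'cV[R]_d) (p : R -> 'M[R]_(d, n)) : Prop :=
  [/\ {within `[0, +oo[, continuous p},
      forall t : R, 0 <= t -> bearings_defined E (p t) &
      forall (t : R) (i : 'I_n), 0 < t ->
        is_derive t 1 (fun s : R => col i (p s)) (control_field E g (p t) i)].

(* Main.v *)
(** The vector [z] from agent 1 to agent 0 has constant length [r], and
    [q = z . g] satisfies [q' = 1 - (q / r)^2].  So [z] converges exponentially
    to [r g] unless [z(0) = - r g], which confines the initial condition to a
    hyperplane.  The length [r] determines the limit configuration: it is the
    reference realization, scaled and translated.
    For a later agent, let [w] be its error, [y_j] the vector to neighbor [j],
    [v_j] the error of that neighbor and [D_j] the limit distance, so that
    [y_j + w = D_j g_j + v_j].  Since the projection kills [y_j], neighbor [j]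
    contributes to [- (|w|^2)' / 2] the term [|P w|^2 / D_j] up to an error
    [|w| |v_j| / D_j].  By Gram determinants (twice the area of a triangle,
    squared), [|P w|^2 = gram y_j w / |y_j|^2 = gram (y_j + w) w / |y_j|^2],
    and [gram g_j w + gram g_k w] is coercive in [w] when [g_j] and [g_k] are
    not parallel.  Gronwall's lemma then gives first boundedness and then
    exponential decay of [w], by induction on the agents. *)

Require Import Defs.
From HB Require Import structures.
From mathcomp Require Import all_boot all_order all_algebra.
From mathcomp Require Import all_classical all_reals all_analysis.
From mathcomp Require Import ring lra.

Set Implicit Arguments.
Unset Strict Implicit.
Unset Printing Implicit Defensive.

Import Order.TTheory GRing.Theory Num.Theory.
Import numFieldNormedType.Exports.

Local Open Scope classical_set_scope.
Local Open Scope ring_scope.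

(** * Euclidean geometry *)

Definition dot (R : realType) (d : nat) (u v : 'cV[R]_d) : R :=
  \sum_(k < d) u k 0 * v k 0.

Definition gram (R : realType) (d : nat) (u v : 'cV[R]_d) : R :=
  dot u u * dot v v - dot u v ^+ 2.

Section EuclideanAlgebra.
Context {R : realType} {d : nat}.
Implicit Types (u v w x y g : 'cV[R]_d) (a D B : R).

Lemma dotC u v : dot u v = dot v u.
Proof. by apply: eq_bigr => k _; rewrite mulrC. Qed.

Lemma dotDl u v w : dot (u + v) w = dot u w + dot v w.
Proof. by rewrite -big_split; apply: eq_bigr => k _; rewrite mxE mulrDl. Qed.

Lemma dotZl a u v : dot (a *: u) v = a * dot u v.
Proof. by rewrite mulr_sumr; apply: eq_bigr => k _; rewrite mxE mulrA. Qed.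

Lemma dotNl u v : dot (- u) v = - dot u v.
Proof. by rewrite -scaleN1r dotZl mulN1r. Qed.

Lemma dotDr u v w : dot u (v + w) = dot u v + dot u w.
Proof. by rewrite dotC dotDl !(dotC u). Qed.

Lemma dotZr a u v : dot u (a *: v) = a * dot u v.
Proof. by rewrite dotC dotZl dotC. Qed.

Lemma dotNr u v : dot u (- v) = - dot u v.
Proof. by rewrite dotC dotNl dotC. Qed.

Definition dotE := (dotDl, dotDr, dotNl, dotNr, dotZl, dotZr).

Lemma dot_sumr (I : finType) (P : pred I) (F : I -> 'cV[R]_d) u :
  dot u (\sum_(i | P i) F i) = \sum_(i | P i) dot u (F i).
Proof.
apply: (big_ind2 (fun v a => dot u v = a)) => [|v a v' a' <- <-|//].
  by rewrite -[0](scale0r 0) dotZr mul0r.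
by rewrite dotDr.
Qed.

Lemma dot_ge0 u : 0 <= dot u u.
Proof. by apply: sumr_ge0 => k _; rewrite -expr2 sqr_ge0. Qed.

Lemma dot_eq0 u : dot u u = 0 -> u = 0.
Proof.
move=> /eqP; rewrite psumr_eq0 => [/allP u0|k _]; last by rewrite -expr2 sqr_ge0.
apply/matrixP => k j; rewrite (ord1 j) mxE.
by have /implyP/(_ isT) := u0 k (mem_index_enum k); rewrite -expr2 sqrf_eq0 => /eqP.
Qed.

Lemma dot_gt0 u : u != 0 -> 0 < dot u u.
Proof.
move=> u0; rewrite lt_neqAle dot_ge0 andbT eq_sym.
by apply/eqP => /dot_eq0 u00; rewrite u00 eqxx in u0.
Qed.

Lemma enorm_sqr u : enorm u ^+ 2 = dot u u.
Proof.
have E : \sum_(i < d) \sum_(j < 1) u i j ^+ 2 = dot u u.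
  by apply: eq_bigr => i _; rewrite big_ord1 expr2.
by rewrite /enorm E sqr_sqrtr ?dot_ge0.
Qed.

Lemma enorm_ge0 m n (A : 'M[R]_(m, n)) : 0 <= enorm A.
Proof. exact: sqrtr_ge0. Qed.

Lemma enorm_gt0 u : u != 0 -> 0 < enorm u.
Proof.
move=> /dot_gt0 u0; rewrite lt_neqAle enorm_ge0 andbT eq_sym.
by rewrite -sqrf_eq0 enorm_sqr gt_eqF.
Qed.

Lemma enormZ a u : 0 <= a -> enorm (a *: u) = a * enorm u.
Proof.
move=> a0; apply/eqP; rewrite -(@eqrXn2 _ 2) ?mulr_ge0 ?enorm_ge0 //.
by rewrite exprMn !enorm_sqr !dotE mulrA.
Qed.

Lemma enormN u : enorm (- u) = enorm u.
Proof.
by apply/eqP; rewrite -(@eqrXn2 _ 2) ?enorm_ge0 // !enorm_sqr !dotE opprK.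
Qed.

Lemma enorm_sqr_col n (A : 'M[R]_(d, n)) :
  enorm A ^+ 2 = \sum_i enorm (col i A) ^+ 2.
Proof.
rewrite /enorm sqr_sqrtr; last by do 2![apply: sumr_ge0 => ? _]; exact: sqr_ge0.
rewrite exchange_big; apply: eq_bigr => i _; rewrite enorm_sqr.
by apply: eq_bigr => k _; rewrite !mxE.
Qed.

Lemma mx_norm_le_enorm m n (A : 'M[R]_(m, n)) : `|A| <= enorm A.
Proof.
rewrite [leLHS]/Num.Def.normr /= mx_normrE; apply: bigmax_le => [|[i j] _] /=.
  exact: enorm_ge0.
rewrite -ler_sqr ?nnegrE ?enorm_ge0 // real_normK ?num_real //.
rewrite sqr_sqrtr; last first.
  by do 2![apply: sumr_ge0 => ? _]; exact: sqr_ge0.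
rewrite (bigD1 i) //= (bigD1 j) //= -addrA lerDl addr_ge0 // sumr_ge0 // => ? _.
  exact: sqr_ge0.
by apply: sumr_ge0 => ? _; exact: sqr_ge0.
Qed.

(** Cauchy-Schwarz: the squared length of [|v|^2 u - (u.v) v] is [|v|^2 * gram u v]. *)
Lemma gram_ge0 u v : 0 <= gram u v.
Proof.
have [->|v0] := eqVneq v 0; first by rewrite /gram -(scale0r u) !dotE; lra.
have := dot_ge0 (dot v v *: u - dot u v *: v); rewrite !dotE (dotC v u).
rewrite (_ : _ + _ = dot v v * gram u v); last by rewrite /gram; ring.
by rewrite pmulr_rge0 // dot_gt0.
Qed.

Lemma dot_le u v : dot u v <= enorm u * enorm v.
Proof.
have := gram_ge0 u v; rewrite /gram -!enorm_sqr -exprMn subr_ge0 => h.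
apply: le_trans (ler_norm _) _; rewrite -ler_sqr ?nnegrE ?mulr_ge0 ?enorm_ge0 //.
by rewrite real_normK ?num_real.
Qed.

(** Equality case of Cauchy-Schwarz: [|u + |u| v|^2 = 2 |u| (|u| + u.v) <= 0]. *)
Lemma dot_le_Nenorm u v : dot v v = 1 -> dot u v <= - enorm u ->
  u = - enorm u *: v.
Proof.
move=> v1 uv; rewrite scaleNr; apply/eqP; rewrite -addr_eq0.
apply/eqP/dot_eq0/le_anti; rewrite dot_ge0 andbT !dotE v1 -enorm_sqr (dotC v).
by have := ler_wpM2l (enorm_ge0 u) uv; lra.
Qed.

(** The two sides differ by [|u - v|^2 + |u + w|^2 + |v + w|^2]. *)
Lemma dotDDB_le u v w :
  dot (u + v - w) (u + v - w) <= 3 * (dot u u + dot v v + dot w w).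
Proof.
have := dot_ge0 (u - v); have := dot_ge0 (u + w); have := dot_ge0 (v + w).
by rewrite !dotE (dotC v u) (dotC w u) (dotC w v); lra.
Qed.

Lemma gramDl u v : gram (u + v) v = gram u v.
Proof. by rewrite /gram !dotE (dotC v u); ring. Qed.

Lemma gramD_le u v w : gram (u + v) w <= 2 * (gram u w + gram v w).
Proof.
have := gram_ge0 (u - v) w; rewrite /gram !dotE (dotC v u) => h.
by rewrite -subr_ge0; apply: le_trans h _; rewrite le_eqVlt; apply/orP; left;
  apply/eqP; ring.
Qed.

(* The quadratic form w |-> (g.w)^2 + (h.w)^2 has largest eigenvalue
   1 + |g.h|. *)
Lemma gram_pair_ge g h w : dot g g = 1 -> dot h h = 1 ->
  (1 - `|dot g h|) * dot w w <= gram g w + gram h w.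
Proof.
move=> g1 h1; rewrite /gram g1 h1.
set a := dot g w; set b := dot h w; set c := dot g h; set W := dot w w.
have W0 : 0 <= W by exact: dot_ge0.
(* Cauchy-Schwarz for [w] and [a g + b h], whose dot product is [a^2 + b^2]: this gives
   [(a^2 + b^2)^2 <= W (a^2 + b^2 + 2abc)], to be divided by [a^2 + b^2]. *)
have := gram_ge0 w (a *: g + b *: h).
rewrite /gram !dotE (dotC h g) (dotC w g) (dotC w h) -/a -/b -/c -/W g1 h1 => H.
have cn := ler_norm (c * (a * b)); rewrite !normrM in cn.
have [n0 na nb] : [/\ 0 <= `|c|, `|a| ^+ 2 = a ^+ 2 & `|b| ^+ 2 = b ^+ 2].
  by rewrite normr_ge0 !real_normK ?num_real.
have ab : 2 * (`|a| * `|b|) <= a ^+ 2 + b ^+ 2.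
  by have := sqr_ge0 (`|a| - `|b|); rewrite -na -nb; nra.
have cab : 2 * (c * (a * b)) <= `|c| * (a ^+ 2 + b ^+ 2) by nra.
have Q0 : 0 <= a ^+ 2 + b ^+ 2 by rewrite addr_ge0 ?sqr_ge0.
have Q2 : (a ^+ 2 + b ^+ 2) * (a ^+ 2 + b ^+ 2) <=
    (a ^+ 2 + b ^+ 2) * (W * (1 + `|c|)) by nra.
suff: a ^+ 2 + b ^+ 2 <= W * (1 + `|c|) by lra.
have [->|Qn] := eqVneq (a ^+ 2 + b ^+ 2) 0; first by rewrite mulr_ge0 ?addr_ge0.
by move: Q2; rewrite ler_pM2l // lt_neqAle eq_sym Qn.
Qed.

(** With [c = u.v], [|v - c u|^2 = 1 - c^2]; if [|c| >= 1] then [v = c u], and the three points lie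
    on the line through [x] directed by [u]. *)
Lemma noncollinear_dot_lt1 x u v a b : dot u u = 1 -> dot v v = 1 ->
  ~ collinear x (x + a *: u) (x + b *: v) -> `|dot u v| < 1.
Proof.
move=> u1 v1 ncol; rewrite ltNge; apply/negP => c1; apply: ncol.
set c := dot u v in c1.
have /dot_eq0/subr0_eq -> : dot (v - c *: u) (v - c *: u) = 0.
  apply/eqP; rewrite eq_le dot_ge0 andbT !dotE u1 v1 (dotC v) -/c.
  by have := real_normK (num_real c); nra.
exists x, u, 0, a, (b * c); split=> //; first by rewrite scale0r addr0.
by rewrite scalerA.
Qed.

(** * Projections and the contribution of one edge *)

Definition projd y u := u - (dot y u / dot y y) *: y.

Lemma proj_orth_mul y g : y != 0 ->
  proj_orth ((enorm y)^-1 *: y) *m g = projd y g.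
Proof.
move=> y0; have yy := dot_gt0 y0.
have ey := enorm_gt0 y0.
have e1 : enorm ((enorm y)^-1 *: y) = 1.
  by rewrite enormZ ?invr_ge0 ?enorm_ge0 // mulVf ?lt0r_neq0.
rewrite /proj_orth e1 expr1n invr1 scale1r mulmxBl mul1mx /projd; congr (_ - _).
rewrite -mulmxA; apply/matrixP => k j; rewrite !ord1 !mxE big_ord1 !mxE.
rewrite (_ : \sum_j _ = (enorm y)^-1 * dot y g); last first.
  by rewrite /dot mulr_sumr; apply: eq_bigr => i _; rewrite !mxE mulrA.
by rewrite -enorm_sqr; field; exact: lt0r_neq0.
Qed.

Lemma dot_projd y u v : y != 0 ->
  dot (projd y u) (projd y v) = dot u (projd y v).
Proof.
move=> /dot_gt0 y0; rewrite /projd !dotE.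
by rewrite (dotC u y); field; exact: lt0r_neq0.
Qed.

(** As [projd y] kills [y], [D * projd y g = projd y w - projd y v]. The first part paired with [w]
    is [gram y w / |y|^2]; the second is bounded by Cauchy-Schwarz. *)
Lemma edge_descent y w g v D : y != 0 -> y + w = D *: g + v ->
  gram y w / dot y y - enorm w * enorm v <= D * dot w (projd y g).
Proof.
move=> y0 E; have yy := dot_gt0 y0.
have Eg : D *: g = y + w - v by rewrite E addrK.
have -> : D * dot w (projd y g) = gram y w / dot y y - dot w (projd y v).
  rewrite -dotZr /projd scalerBr scalerA.
  rewrite (_ : D * (dot y g / dot y y) = dot y (D *: g) / dot y y); last first.
    by rewrite dotZr mulrA.
  rewrite Eg /gram !dotE (dotC w y); field; exact: lt0r_neq0.
rewrite lerD2l lerN2; apply: le_trans (dot_le _ _) _.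
rewrite ler_wpM2l ?enorm_ge0 // -ler_sqr ?nnegrE ?enorm_ge0 // !enorm_sqr.
(* Projecting does not lengthen: [|projd y v|^2 = |v|^2 - (y.v)^2 / |y|^2]. *)
rewrite dot_projd // /projd !dotE (dotC v y) lerBlDr lerDl -mulrAC -expr2.
by rewrite mulr_ge0 ?sqr_ge0 // invr_ge0 ltW.
Qed.

(** Needs no upper bound on [|y|], hence is usable before boundedness is known. *)
Lemma edge_descent_weak y w g v D : y != 0 -> y + w = D *: g + v ->
  - (enorm w * enorm v) <= D * dot w (projd y g).
Proof.
move=> y0 /(edge_descent y0); apply: le_trans.
by rewrite lerDr mulr_ge0 ?gram_ge0 // invr_ge0 dot_ge0.
Qed.

(** Trades the moving direction [y] for the fixed [g]: as [D g = (y + w) - v],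
    [D^2 gram g w <= 2 (gram y w + gram v w)], and [gram v w <= |v|^2 |w|^2]. *)
Lemma edge_descent_strong y w g v D B : y != 0 -> y + w = D *: g + v ->
  dot y y <= B ->
  (D ^+ 2 / 2 * gram g w - dot v v * dot w w) / B - enorm w * enorm v
    <= D * dot w (projd y g).
Proof.
move=> y0 E yB; apply: le_trans (edge_descent y0 E); rewrite lerD2r.
have yy := dot_gt0 y0; have B0 := lt_le_trans yy yB.
have G : D ^+ 2 / 2 * gram g w - dot v v * dot w w <= gram y w.
  have := gramD_le (y + w) (- v) w; rewrite gramDl E addrK.
  have : gram (- v) w <= dot v v * dot w w.
    by rewrite /gram !dotE opprK lerBlDr lerDl sqr_ge0.
  have -> : gram (D *: g) w = D ^+ 2 * gram g w by rewrite /gram !dotE; ring.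
  by lra.
apply: (@le_trans _ _ (gram y w / B)); first by rewrite ler_pM2r ?invr_gt0.
by rewrite ler_wpM2l ?gram_ge0 // lef_pV2.
Qed.

End EuclideanAlgebra.

(** * Differential inequalities on a half-line *)

Definition ray_derive (R : realType) (f df : R -> R) : Prop :=
  {within `[0, +oo[, continuous f} /\
  forall t : R, 0 < t -> is_derive t 1 f (df t).

(** With [C] nonnegative, lowering the rate weakens the bound, so different rates can be merged. *)
Definition exp_decay (R : realType) (f : R -> R) : Prop :=
  exists C l : R, [/\ 0 <= C, 0 < l &
    forall t : R, 0 <= t -> f t <= C * expR (- l * t)].

Section RayDerive.
Context {R : realType}.
Implicit Types (f g df dg : R -> R) (a c k l : R).

Lemma ray_derive_eq f df dg : ray_derive f df ->
  (forall t, 0 < t -> df t = dg t) -> ray_derive f dg.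
Proof. by move=> [cf Df] E; split=> // t t0; rewrite -E //; exact: Df. Qed.

Lemma ray_derive_cst c : ray_derive (fun=> c) (fun=> 0 : R).
Proof.
split=> [|t t0]; last exact: is_derive_cst.
by move=> x; exact: cst_continuous.
Qed.

Lemma ray_deriveD f g df dg : ray_derive f df -> ray_derive g dg ->
  ray_derive (fun t => f t + g t) (fun t => df t + dg t).
Proof.
move=> [cf Df] [cg Dg]; split=> [x|t t0]; first exact: cvgD (cf x) (cg x).
exact: is_deriveD (Df _ t0) (Dg _ t0).
Qed.

Lemma ray_deriveM f g df dg : ray_derive f df -> ray_derive g dg ->
  ray_derive (fun t => f t * g t) (fun t => df t * g t + f t * dg t).
Proof.
move=> [cf Df] [cg Dg]; split=> [x|t t0]; first exact: cvgM (cf x) (cg x).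
apply: is_derive_eq (is_deriveM (Df _ t0) (Dg _ t0)) _.
by rewrite addrC /GRing.scale /= (mulrC (g t)).
Qed.

Lemma ray_derive_sum (I : finType) (P : pred I) (F dF : I -> R -> R) :
  (forall i, P i -> ray_derive (F i) (dF i)) ->
  ray_derive (fun t => \sum_(i | P i) F i t) (fun t => \sum_(i | P i) dF i t).
Proof.
move=> H.
have: ray_derive (\sum_(i | P i) F i) (\sum_(i | P i) dF i).
  apply: (big_ind2 (fun f df => ray_derive f df)) => [|f df g dg|//].
    exact: ray_derive_cst.
  exact: ray_deriveD.
by rewrite !fct_sumE.
Qed.

Lemma ray_derive_expR a :
  ray_derive (fun t => expR (a * t)) (fun t => a * expR (a * t)).
Proof.
have D (t : R) : is_derive t 1 (fun t : R => expR (a * t)) (a * expR (a * t)).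
  have Da : is_derive t 1 (fun t : R => a * t) a.
    apply: is_derive_eq (is_deriveZ a (is_derive_id t 1)) _.
    by rewrite /GRing.scale /= mulr1.
  apply: is_derive_eq (is_derive1_comp (is_derive_expR (a * t)) Da) _.
  by rewrite mulrC.
split=> [|t _]; last exact: D.
apply: continuous_subspaceT => t.
by apply/differentiable_continuous/derivable1_diffP; case: (D t).
Qed.

Lemma ray_derive_comp_expR f df : ray_derive f df ->
  ray_derive (fun t => expR (f t)) (fun t => df t * expR (f t)).
Proof.
move=> [cf Df]; split=> [x|t t0].
  exact: continuous_comp (cf x) (@continuous_expR R _).
apply: is_derive_eq (is_derive1_comp (is_derive_expR (f t)) (Df t t0)) _.
by rewrite mulrC.
Qed.

Lemma ray_nonincr f df : ray_derive f df -> (forall t, 0 < t -> df t <= 0) ->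
  forall s t, 0 <= s -> s <= t -> f t <= f s.
Proof.
move=> [cf Df] df0 s t s0; rewrite le_eqVlt => /predU1P[->//|st].
have [||c] := @MVT _ f df _ _ st.
- by move=> x; rewrite in_itv /= => /andP[sx _]; apply: Df; exact: le_lt_trans sx.
- apply: continuous_subspaceW cf; apply: subset_itv => //; rewrite bnd_simp //.
rewrite in_itv /= => /andP[sc _] fst.
have := df0 c (le_lt_trans s0 sc) => dc.
by rewrite -subr_le0 fst mulr_le0_ge0 // subr_ge0 ltW.
Qed.

Lemma ray_const f df : ray_derive f df -> (forall t, 0 < t -> df t = 0) ->
  forall t, 0 <= t -> f t = f 0.
Proof.
move=> fdf df0 t t0; apply/eqP; rewrite eq_le (ray_nonincr fdf) //=; last first.
  by move=> s /df0 ->.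
have := ray_nonincr (ray_deriveM (ray_derive_cst (-1)) fdf) _ (lexx 0) t0.
rewrite !mulN1r lerN2; apply => s /df0 ->; lra.
Qed.

(** The integrating factor is [expR (k / l * expR (- l * t))]: it starts at [expR (k / l)], stays at
    least 1, and makes its product with [f] nonincreasing. *)
Lemma gronwall_bounded f df k l : ray_derive f df -> 0 < l -> 0 <= k ->
  (forall t, 0 <= t -> 0 <= f t) ->
  (forall t, 0 < t -> df t <= k * expR (- l * t) * f t) ->
  forall t, 0 <= t -> f t <= f 0 * expR (k / l).
Proof.
move=> fdf l0 k0 f0 dfle t t0.
have E := ray_derive_comp_expR
  (ray_deriveM (ray_derive_cst (k / l)) (ray_derive_expR (- l))).
have F := ray_deriveM fdf E.
have /(_ _ _ _ (lexx 0) t0) := ray_nonincr F.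
rewrite /= mulr0 expR0 mulr1 => /(_ _) H; apply: le_trans (H _).
  by rewrite ler_peMr ?f0 // -expR0 ler_expR mulr_ge0 ?expR_ge0 // divr_ge0 // ltW.
move=> s s0; have {}dfle := dfle s s0; set X := expR (k / l * _).
have -> : df s * X + f s * ((0 * expR (- l * s) +
    k / l * (- l * expR (- l * s))) * X) = (df s - k * expR (- l * s) * f s) * X.
  by field; exact: lt0r_neq0.
by rewrite mulr_le0_ge0 ?expR_ge0 // subr_le0.
Qed.

Lemma gronwall_decay f df c k l : ray_derive f df -> 0 < c -> 0 < l -> 0 <= k ->
  (forall t, 0 <= t -> 0 <= f t) ->
  (forall t, 0 < t -> df t <= - c * f t + k * expR (- l * t)) ->
  exp_decay f.
Proof.
move=> fdf c0 l0 k0 f0 dfle.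
(* The rate must satisfy [m <= c] and, strictly, [m < l]; taking [l / 2] avoids the resonant case
   [c = l]. Then [f e^(mt) + k / (l - m) e^(-(l - m)t)] is nonincreasing. *)
pose m := Num.min c (l / 2).
have m0 : 0 < m by rewrite lt_min c0 divr_gt0.
have mc : m <= c by rewrite ge_min lexx.
have ml : 0 < l - m.
  have : m <= l / 2 by rewrite ge_min lexx orbT.
  by lra.
have F := ray_deriveD (ray_deriveM fdf (ray_derive_expR m))
  (ray_deriveM (ray_derive_cst (k / (l - m))) (ray_derive_expR (- (l - m)))).
exists (f 0 + k / (l - m)), m; split=> // [|t t0].
  by rewrite addr_ge0 ?f0 // divr_ge0 // ltW.
have /(_ _ _ _ (lexx 0) t0) := ray_nonincr F.
rewrite !mulr0 expR0 !mulr1 => /(_ _) H.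
rewrite -ler_pdivrMr ?expR_gt0 // mulNr expRN invrK.
apply: le_trans (H _); first by rewrite lerDl mulr_ge0 ?expR_ge0 // divr_ge0 // ltW.
move=> s s0; have {}dfle := dfle s s0.
have E : expR (- (l - m) * s) = expR (- l * s) * expR (m * s).
  by rewrite -expRD; congr expR; ring.
rewrite E; set X := expR (m * s) in E *; set Y := expR (- l * s) in E dfle *.
have -> : df s * X + f s * (m * X) + (0 * (Y * X) +
    k / (l - m) * (- (l - m) * (Y * X))) = (df s + m * f s - k * Y) * X.
  by field; exact: lt0r_neq0.
rewrite mulr_le0_ge0 ?expR_ge0 //.
have : m * f s <= c * f s by rewrite ler_wpM2r // f0 ?ltW.
lra.
Qed.

(** * Closure properties of exponential decay *)

Lemma exp_decay_le f g : exp_decay g -> (forall t, 0 <= t -> f t <= g t) ->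
  exp_decay f.
Proof.
move=> [C [l [C0 l0 gC]]] fg; exists C, l; split=> // t t0.
exact: le_trans (fg t t0) (gC t t0).
Qed.

Lemma exp_decay0 : exp_decay (fun=> 0 : R).
Proof. by exists 0, 1; split=> // t _; rewrite mul0r. Qed.

Lemma exp_decayD f g : exp_decay f -> exp_decay g ->
  exp_decay (fun t => f t + g t).
Proof.
move=> [C [l [C0 l0 fC]]] [D [m [D0 m0 gD]]].
exists (C + D), (Num.min l m); split=> [||t t0]; first exact: addr_ge0.
  by rewrite lt_min l0.
rewrite mulrDl; apply: lerD.
  apply: le_trans (fC t t0) _; rewrite ler_wpM2l // ler_expR !mulNr lerN2.
  by rewrite ler_wpM2r // ge_min lexx.
apply: le_trans (gD t t0) _; rewrite ler_wpM2l // ler_expR !mulNr lerN2.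
by rewrite ler_wpM2r // ge_min lexx orbT.
Qed.

Lemma exp_decayZ c f : 0 <= c -> exp_decay f -> exp_decay (fun t => c * f t).
Proof.
move=> c0 [C [l [C0 l0 fC]]]; exists (c * C), l; split=> // [|t t0].
  exact: mulr_ge0.
by rewrite -mulrA ler_wpM2l // fC.
Qed.

Lemma exp_decay_sum (I : finType) (P : pred I) (F : I -> R -> R) :
  (forall i, P i -> exp_decay (F i)) ->
  exp_decay (fun t => \sum_(i | P i) F i t).
Proof.
move=> H; have: exp_decay (\sum_(i | P i) F i).
  apply: (big_ind (fun f => exp_decay f)) => //; first exact: exp_decay0.
  exact: exp_decayD.
by rewrite fct_sumE.
Qed.

Lemma exp_decay_sqrt f : (forall t, 0 <= t -> 0 <= f t) ->
  exp_decay (fun t => f t ^+ 2) -> exp_decay f.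
Proof.
move=> f0 [C [l [C0 l0 fC]]]; exists (Num.sqrt C), (l / 2); split=> [||t t0].
- exact: sqrtr_ge0.
- exact: divr_gt0.
rewrite -ler_sqr ?nnegrE ?f0 ?mulr_ge0 ?sqrtr_ge0 ?expR_ge0 //.
rewrite exprMn sqr_sqrtr // -expRM_natl; apply: le_trans (fC t t0) _.
by rewrite le_eqVlt; apply/orP; left; apply/eqP; congr (_ * expR _); field.
Qed.

Lemma exp_decay_bounded f : exp_decay f ->
  exists2 M, 0 <= M & forall t, 0 <= t -> f t <= M.
Proof.
move=> [C [l [C0 l0 fC]]]; exists C => // t t0; apply: le_trans (fC t t0) _.
by rewrite ler_piMr // -expR0 ler_expR mulNr oppr_le0 mulr_ge0 // ltW.
Qed.

Lemma exp_decay_sqr f : (forall t, 0 <= t -> 0 <= f t) -> exp_decay f ->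
  exp_decay (fun t => f t ^+ 2).
Proof.
move=> f0 df; have [M M0 fM] := exp_decay_bounded df.
apply: exp_decay_le (exp_decayZ M0 df) _ => t t0.
by rewrite expr2 ler_wpM2r ?f0 ?fM.
Qed.

End RayDerive.

(** * Convergence of the followers *)

Definition ray_derive_col (R : realType) (d : nat) (u du : R -> 'cV[R]_d) :=
  forall k : 'I_d, ray_derive (fun t => u t k 0) (fun t => du t k 0).

Section Followers.
Context {R : realType} {d : nat}.
Implicit Types (u v du dv : R -> 'cV[R]_d).

Lemma ray_derive_dot u v du dv : ray_derive_col u du -> ray_derive_col v dv ->
  ray_derive (fun t => dot (u t) (v t))
    (fun t => dot (du t) (v t) + dot (u t) (dv t)).
Proof.
move=> Du Dv; have := ray_derive_sum (P := xpredT)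
  (fun k _ => ray_deriveM (Du k) (Dv k)).
by move/ray_derive_eq; apply => t _; rewrite -big_split.
Qed.

Lemma ray_derive_col_cst (c : 'cV[R]_d) : ray_derive_col (fun=> c) (fun=> 0).
Proof.
by move=> k; apply: ray_derive_eq (ray_derive_cst (c k 0)) _ => t _; rewrite mxE.
Qed.

Lemma ray_derive_colD u v du dv : ray_derive_col u du -> ray_derive_col v dv ->
  ray_derive_col (fun t => u t + v t) (fun t => du t + dv t).
Proof.
move=> Du Dv k; have := ray_deriveD (Du k) (Dv k).
rewrite (_ : (fun t => u t k 0 + v t k 0) = (fun t => (u t + v t) k 0)).
  by move/ray_derive_eq; apply => t _; rewrite mxE.
by apply/funext => t; rewrite mxE.
Qed.

Lemma ray_derive_colN u du : ray_derive_col u du ->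
  ray_derive_col (fun t => - u t) (fun t => - du t).
Proof.
move=> Du k; have := ray_deriveM (ray_derive_cst (-1)) (Du k).
rewrite (_ : (fun t => -1 * u t k 0) = (fun t => (- u t) k 0)).
  by move/ray_derive_eq; apply => t _; rewrite mxE; ring.
by apply/funext => t; rewrite mxE mulN1r.
Qed.

(** The gap [r - q] satisfies [(r - q)' = - (r + q) / r^2 (r - q)], and [r + q] stays above its
    positive initial value because [q] is nondecreasing. *)
Lemma first_follower_decay (z : R -> 'cV[R]_d) (h : 'cV[R]_d) :
  ray_derive_col z (fun t => projd (z t) h) ->
  (forall t, 0 <= t -> z t != 0) -> dot h h = 1 ->
  - enorm (z 0) < dot (z 0) h ->
  exp_decay (fun t => enorm (z t - enorm (z 0) *: h)).
Proof.
move=> Dz z0 h1 zh0.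
set r := enorm (z 0); set q := fun t => dot (z t) h.
have zz t : 0 <= t -> dot (z t) (z t) = r ^+ 2.
  move=> t0; rewrite /r enorm_sqr.
  apply: (ray_const (ray_derive_dot Dz Dz)) t0 => s /ltW/z0/dot_gt0 zs.
  by rewrite /projd !dotE (dotC h); field; exact: lt0r_neq0.
have r0 : 0 < r by rewrite enorm_gt0 ?z0.
have Dq : ray_derive q (fun t => 1 - q t ^+ 2 / r ^+ 2).
  apply: ray_derive_eq (ray_derive_dot Dz (ray_derive_col_cst h)) _ => t t0.
  rewrite -[0](scale0r h) /projd /q !dotE h1 (zz _ (ltW t0)); field.
  exact: lt0r_neq0.
have eh : enorm h = 1.
  by apply/eqP; rewrite -(@eqrXn2 _ 2) ?enorm_ge0 // expr1n enorm_sqr h1.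
have qr t : 0 <= t -> q t <= r /\ - r <= q t.
  move=> t0; have er : enorm (z t) = r.
    by apply/eqP; rewrite -(@eqrXn2 _ 2) ?enorm_ge0 // enorm_sqr zz.
  split; first by have := dot_le (z t) h; rewrite er eh mulr1.
  by have := dot_le (- z t) h; rewrite dotNl enormN er eh mulr1 -/(q t); lra.
have dq0 t : 0 <= t -> 0 <= 1 - q t ^+ 2 / r ^+ 2.
  move=> t0; have [q1 q2] := qr t t0.
  by rewrite subr_ge0 ler_pdivrMr ?exprn_gt0 // mul1r; nra.
have qinc t : 0 <= t -> q 0 <= q t.
  have DNq := ray_deriveM (ray_derive_cst (-1)) Dq.
  move=> t0; have := ray_nonincr DNq _ (lexx 0) t0.
  rewrite !mulN1r lerN2; apply => s /ltW/dq0; lra.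
have Dh := ray_deriveD (ray_derive_cst r) (ray_deriveM (ray_derive_cst (-1)) Dq).
have c0 : 0 < (r + q 0) / r ^+ 2.
  by rewrite divr_gt0 ?exprn_gt0 //; move: zh0; rewrite -/r -/(q 0); lra.
have : exp_decay (fun t => r + -1 * q t).
  (* No forcing term: [k = 0], and the forcing rate 1 is arbitrary. *)
  apply: (gronwall_decay Dh c0 ltr01 (lexx 0)) => [t /qr[]|t t0]; first lra.
  rewrite !mul0r !add0r addr0.
  have [q1 q2] := qr t (ltW t0); have q3 := qinc t (ltW t0).
  have -> : -1 * (1 - q t ^+ 2 / r ^+ 2) = - ((r + q t) / r ^+ 2 * (r + -1 * q t)).
    by field; exact: lt0r_neq0.
  rewrite [leRHS]mulNr lerN2 ler_wpM2r //; first lra.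
  by rewrite ler_pM2r ?invr_gt0 ?exprn_gt0 // lerD2l.
(* Since [|z| = r], [|z - r h|^2 = 2 r (r - q)]. *)
move/(exp_decayZ (c := 2 * r)) => H; apply: exp_decay_sqrt => [t _|].
  exact: enorm_ge0.
apply: exp_decay_le (H _) _ => [|t t0]; first by rewrite mulr_ge0 // ltW.
rewrite enorm_sqr !dotE h1 zz // (dotC h) -/(q t) le_eqVlt; apply/orP; left.
by apply/eqP; ring.
Qed.

Lemma follower_decay (I : finType) (P : pred I) (x : R -> 'cV[R]_d)
    (q : I -> R -> 'cV[R]_d) (h qoo : I -> 'cV[R]_d) (xoo : 'cV[R]_d)
    (D : I -> R) (j1 j2 : I) :
  ray_derive_col x (fun t => - \sum_(j | P j) projd (q j t - x t) (h j)) ->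
  (forall j t, P j -> 0 <= t -> q j t - x t != 0) ->
  (forall j, P j -> dot (h j) (h j) = 1) ->
  (forall j, P j -> 0 < D j) ->
  (forall j, P j -> qoo j - xoo = D j *: h j) ->
  (forall j, P j -> exp_decay (fun t => enorm (q j t - qoo j))) ->
  P j1 -> P j2 -> j1 != j2 -> `|dot (h j1) (h j2)| < 1 ->
  exp_decay (fun t => enorm (x t - xoo)).
Proof.
move=> Dx y0 h1 D0 Dh Eq Pj1 Pj2 j12 h12.
pose w t := x t - xoo; pose V t := dot (w t) (w t).
pose y j t := q j t - x t; pose e j t := q j t - qoo j.
(* The weights come from dividing the edge estimates by [D j]. *)
pose S t := \sum_(j | P j) (D j)^-1 * enorm (e j t).
have V0 t : 0 <= V t by exact: dot_ge0.
have ywE j t : P j -> y j t + w t = D j *: h j + e j t.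
  by move=> Pj; rewrite -Dh //; apply/matrixP => k i; rewrite !mxE; ring.
have DV : ray_derive V
    (fun t => - 2 * \sum_(j | P j) dot (w t) (projd (y j t) (h j))).
  have Dw := ray_derive_colD Dx (ray_derive_col_cst (- xoo)).
  apply: ray_derive_eq (ray_derive_dot Dw Dw) _ => t _.
  rewrite addr0 [X in X + _]dotC dotNr dot_sumr; ring.
have [K [l [K0 l0 SK]]] : exp_decay S.
  apply: exp_decay_sum => j Pj; apply: exp_decayZ (Eq j Pj).
  by rewrite invr_ge0 ltW ?D0.
have bound t : 2 * enorm (w t) <= 1 + V t.
  rewrite /V -enorm_sqr; have := sqr_ge0 (enorm (w t) - 1); nra.
have S0 t : 0 <= S t.
  apply: sumr_ge0 => j Pj; rewrite mulr_ge0 ?enorm_ge0 // invr_ge0 ltW //.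
  exact: D0.
have [M M0 VM] : exists2 M, 0 <= M & forall t, 0 <= t -> V t <= M.
  have D1V := ray_deriveD (ray_derive_cst 1) DV.
  have V1 t : 0 <= t -> 0 <= 1 + V t by rewrite addr_ge0.
  exists ((1 + V 0) * expR (K / l)); first by rewrite mulr_ge0 ?expR_ge0 ?V1.
  move=> t t0; have := gronwall_bounded D1V l0 K0 V1 _ t0.
  move=> H; apply: le_trans (H _) => [|s s0]; first by rewrite lerDr.
  rewrite add0r; apply: (@le_trans _ _ (S s * (1 + V s))).
    rewrite mulNr -mulrN -sumrN mulr_sumr mulr_suml; apply: ler_sum => j Pj.
    have Di : 0 <= (D j)^-1 by rewrite invr_ge0 ltW ?D0.
    have := ler_wpM2l Di (edge_descent_weak (y0 j s Pj (ltW s0)) (ywE j s Pj)).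
    rewrite mulKf ?lt0r_neq0 ?D0 // => He.
    have := ler_wpM2l (mulr_ge0 Di (enorm_ge0 (e j s))) (bound s); lra.
  by rewrite ler_wpM2r ?V1 ?SK // ltW.
have eK j t : P j -> 0 <= t -> enorm (e j t) <= D j * K.
  move=> Pj t0; rewrite -ler_pdivrMl ?D0 //.
  apply: (@le_trans _ _ (S t)); last first.
    apply: le_trans (SK t t0) _.
    by rewrite ler_piMr // -expR0 ler_expR mulNr oppr_le0 mulr_ge0 // ltW.
  rewrite /S (bigD1 j) //= lerDl; apply: sumr_ge0 => i /andP[Pi _].
  by rewrite mulr_ge0 ?enorm_ge0 // invr_ge0 ltW ?D0.
have [B [B0 yB]] : exists B, 0 < B /\
    forall j t, P j -> 0 <= t -> dot (y j t) (y j t) <= B.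
  pose b j := 3 * (D j ^+ 2 + (D j * K) ^+ 2 + M).
  have b0 j : 0 <= b j by rewrite mulr_ge0 // !addr_ge0 ?sqr_ge0.
  exists (1 + \sum_(j | P j) b j); split=> [|j t Pj t0].
    by rewrite ltr_wpDr // sumr_ge0.
  apply: (@le_trans _ _ (b j)); last first.
    rewrite (bigD1 j) //= addrCA lerDl addr_ge0 // sumr_ge0 // => i _; exact: b0.
  have -> : y j t = D j *: h j + e j t - w t by rewrite -ywE // addrK.
  apply: le_trans (dotDDB_le _ _ _) _; rewrite ler_pM2l //.
  rewrite !lerD ?VM //; first by rewrite !dotE h1 // mulr1.
  by rewrite -enorm_sqr ler_sqr ?nnegrE ?enorm_ge0 ?eK // mulr_ge0 // ltW ?D0.
pose G t := \sum_(j | P j) (D j / B) * gram (h j) (w t).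
pose Q t := \sum_(j | P j) (2 * M / (D j * B)) * dot (e j t) (e j t).
have [c c0 cG] : exists2 c, 0 < c & forall t, c * V t <= G t.
  pose m := Num.min (D j1) (D j2).
  have m0 : 0 < m by rewrite lt_min !D0.
  exists (m / B * (1 - `|dot (h j1) (h j2)|)).
    by rewrite mulr_gt0 ?divr_gt0 // subr_gt0.
  move=> t; rewrite /G (bigD1 j1) //= (bigD1 j2) /=; last by rewrite Pj2 eq_sym.
  rewrite addrA; apply: ler_wpDr.
    apply: sumr_ge0 => j /andP[/andP[Pj _] _].
    by rewrite mulr_ge0 ?gram_ge0 // divr_ge0 // ltW ?D0.
  have g12 := gram_pair_ge (w t) (h1 _ Pj1) (h1 _ Pj2).
  rewrite -mulrA.
  apply: (@le_trans _ _ (m / B * (gram (h j1) (w t) + gram (h j2) (w t)))).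
    by rewrite ler_wpM2l // divr_ge0 // ltW.
  rewrite mulrDr; apply: lerD; rewrite ler_wpM2r ?gram_ge0 //.
    by rewrite ler_pM2r ?invr_gt0 // ge_min lexx.
  by rewrite ler_pM2r ?invr_gt0 // ge_min lexx orbT.
have [K' [l' [K0' l0' SK']]] : exp_decay (fun t => (1 + M) * S t + Q t).
  apply: exp_decayD.
    by apply: exp_decayZ; [exact: addr_ge0|exists K, l].
  apply: exp_decay_sum => j Pj; apply: exp_decayZ.
    by rewrite divr_ge0 ?mulr_ge0 // ltW ?D0.
  apply: exp_decay_le (exp_decay_sqr _ (Eq j Pj)) _ => t _; first exact: enorm_ge0.
  by rewrite enorm_sqr.
have : exp_decay V.
  apply: (gronwall_decay DV c0 l0' K0' (fun t _ => V0 t)) => t t0.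
  apply: (@le_trans _ _ (- G t + ((1 + M) * S t + Q t))); last first.
    by rewrite lerD ?SK' ?(ltW t0) // [leRHS]mulNr lerN2.
  rewrite mulNr -mulrN -sumrN /G /S /Q mulr_sumr -sumrN mulr_sumr -!big_split.
  apply: ler_sum => j Pj /=.
  have Dj := D0 j Pj; have Dn := lt0r_neq0 Dj; have Bn := lt0r_neq0 B0.
  have Hs := edge_descent_strong (y0 j t Pj (ltW t0)) (ywE j t Pj)
    (yB j t Pj (ltW t0)).
  have D2 : 0 <= 2 / D j by rewrite divr_ge0 // ltW.
  have := ler_wpM2l D2 Hs; rewrite -/(V t).
  have -> a : 2 / D j * (D j * a) = 2 * a by field.
  have : 2 * enorm (w t) <= 1 + M.
    by apply: le_trans (bound t) _; rewrite lerD2l VM ?ltW.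
  have Di : 0 <= (D j)^-1 by rewrite invr_ge0 ltW.
  move=> /(ler_wpM2l (mulr_ge0 Di (enorm_ge0 (e j t)))).
  have : 0 <= 2 / (D j * B) * dot (e j t) (e j t).
    by rewrite mulr_ge0 ?dot_ge0 // divr_ge0 // ltW ?mulr_gt0.
  move=> /ler_wpM2l/(_ _ _ (VM t (ltW t0))).
  have -> : 2 / D j * ((D j ^+ 2 / 2 * gram (h j) (w t)
      - dot (e j t) (e j t) * V t) / B - enorm (w t) * enorm (e j t)) =
      D j / B * gram (h j) (w t)
      - 2 / (D j * B) * dot (e j t) (e j t) * V t
      - (D j)^-1 * enorm (e j t) * (2 * enorm (w t)) by field; rewrite Dn Bn.
  have -> : 2 * M / (D j * B) * dot (e j t) (e j t) =
    2 / (D j * B) * dot (e j t) (e j t) * M by field; rewrite Dn Bn.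
  lra.
rewrite /V => HV; apply: exp_decay_sqrt => [t _|]; first exact: enorm_ge0.
by apply: exp_decay_le HV _ => t _; rewrite enorm_sqr.
Qed.

End Followers.

(** * Null sets *)

Section NullSets.
Context {R : realType} {m n : nat}.
Implicit Types (N : set 'M[R]_(m, n)) (x y : 'M[R]_(m, n)).

Lemma lebesgue_null_countable_cover N : (0 < m)%N -> (0 < n)%N ->
  (forall eps : R, 0 < eps -> exists (T : countType) (a b : T -> 'M[R]_(m, n)),
    [/\ forall k i j, a k i j <= b k i j,
        N `<=` \bigcup_k [set x | forall i j, a k i j <= x i j <= b k i j] &
        (\esum_(k in [set: T])
           (\prod_(i < m) \prod_(j < n) (b k i j - a k i j))%:E <= eps%:E)%E]) ->
  lebesgue_null N.
Proof.
move=> m0 n0 cov eps /cov[T [a [b [ab Nab vol]]]].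
pose ext (c : T -> 'M[R]_(m, n)) (k : nat) :=
  if pickle_inv k is Some t then c t else 0.
exists (ext a), (ext b); split=> [k i j|x /Nab[t _ xt]|].
- by rewrite /ext; case: pickle_inv => [t|//]; exact: ab.
- by exists (pickle t) => //; rewrite /ext pickleK_inv.
pose v (c e : nat -> 'M[R]_(m, n)) k :=
  \prod_(i < m) \prod_(j < n) (e k i j - c k i j).
have v0 k : 0 <= v (ext a) (ext b) k.
  apply: prodr_ge0 => i _; apply: prodr_ge0 => j _; rewrite subr_ge0 /ext.
  by case: pickle_inv => [t|//]; exact: ab.
rewrite nneseries_esumT => [|k]; last by rewrite lee_fin v0.
apply: le_trans vol; rewrite le_eqVlt; apply/orP; left; apply/eqP.
rewrite (_ : \esum_(k in [set: T]) _ =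
    \esum_(k in [set: T]) (v (ext a) (ext b) (pickle k))%:E)%E; last first.
  by apply: eq_esum => t _; rewrite /v /ext pickleK_inv.
rewrite -(esum_image _ pickle (fun k => (v (ext a) (ext b) k)%:E)); last first.
  by move=> s t _ _ /(pcan_inj pickleK).
rewrite [RHS]esum_mkcond; apply: eq_esum => k _; case: ifPn => // kT; congr (_%:E).
have Ek : pickle_inv k = None :> option T.
  case E: (pickle_inv k) => [t|//]; case/negP: kT; rewrite inE; exists t => //.
  by have := @pickle_invK T k; rewrite E.
rewrite /ext Ek; apply/eqP/prodf_eq0; exists (Ordinal m0) => //.
by apply/prodf_eq0; exists (Ordinal n0) => //; rewrite !mxE subrr.
Qed.

Lemma lebesgue_null_finite_cover N : (0 < m)%N -> (0 < n)%N ->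
  (forall eps : R, 0 < eps -> exists (T : finType) (a b : T -> 'M[R]_(m, n)),
    [/\ forall k i j, a k i j <= b k i j,
        N `<=` \bigcup_k [set x | forall i j, a k i j <= x i j <= b k i j] &
        \sum_k \prod_(i < m) \prod_(j < n) (b k i j - a k i j) <= eps]) ->
  lebesgue_null N.
Proof.
move=> m0 n0 cov; apply: lebesgue_null_countable_cover => // eps.
move=> /cov[T [a [b [ab Nab vol]]]]; exists T, a, b; split=> //.
have finT : finite_set [set: T] by exact: finite_finset.
rewrite esum_fset //; last first.
  move=> k _; rewrite lee_fin; apply: prodr_ge0 => i _; apply: prodr_ge0 => j _.
  by rewrite subr_ge0.
rewrite fsumEFin // lee_fin; apply: le_trans vol.
rewrite (_ : [set: T] = [set` enum T]); last first.
  by apply/seteqP; split => // k _ /=; rewrite mem_enum.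
by rewrite -fsbig_seq ?enum_uniq // big_enum.
Qed.

Lemma lebesgue_null_bigcup (N : nat -> set 'M[R]_(m, n)) :
  (0 < m)%N -> (0 < n)%N ->
  (forall k, lebesgue_null (N k)) -> lebesgue_null (\bigcup_k N k).
Proof.
move=> m0 n0 nullN; apply: lebesgue_null_countable_cover => // eps eps0.
have epsk k : 0 < eps / (2 ^ k.+1)%:R by rewrite divr_gt0 // ltr0n expn_gt0.
have /choice[ab Hab] k : exists ab : (nat -> 'M[R]_(m, n)) * (nat -> 'M[R]_(m, n)),
    [/\ forall l i j, ab.1 l i j <= ab.2 l i j,
      N k `<=` \bigcup_l [set x | forall i j, ab.1 l i j <= x i j <= ab.2 l i j] &
      (\sum_(0 <= l <oo) (\prod_(i < m) \prod_(j < n) (ab.2 l i j - ab.1 l i j))%:E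
         <= (eps / (2 ^ k.+1)%:R)%:E)%E].
  by have [a [b H]] := nullN k _ (epsk k); exists (a, b).
exists (nat * nat)%type, (fun k => (ab k.1).1 k.2), (fun k => (ab k.1).2 k.2).
split=> [k i j|x [k _ Nx]|]; first by have [H _ _] := Hab k.1.
  have [_ /(_ _ Nx)[l _ xl] _] := Hab k; by exists (k, l).
pose v k l := \prod_(i < m) \prod_(j < n) ((ab k).2 l i j - (ab k).1 l i j).
have v0 k l : (0 <= (v k l)%:E)%E.
  rewrite lee_fin; apply: prodr_ge0 => i _; apply: prodr_ge0 => j _.
  by rewrite subr_ge0; have [H _ _] := Hab k.
rewrite (_ : [set: nat * nat] = [set: nat] `*`` (fun=> [set: nat])); last first.
  by apply/seteqP; split.
rewrite -(@esum_esum _ _ _ setT (fun=> setT) (fun k l => (v k l)%:E)) //.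
have := @epsilon_trick0 R eps xpredT (ltW eps0); apply: le_trans.
rewrite nneseries_esumT => [|k]; last by rewrite lee_fin ltW.
apply: le_esum => k _; rewrite -nneseries_esumT //; by have [_ _] := Hab k.
Qed.

Lemma grid_cell (u s z : R) M : u <= z <= u + M.+1%:R * s ->
  exists c : 'I_M.+1, u + c%:R * s <= z <= u + c%:R * s + s.
Proof.
elim: M => [|M IH] /andP[uz zu]; first by exists ord0;
  rewrite mul0r addr0 uz -[s]mul1r.
have [zM|Mz] := leP z (u + M.+1%:R * s).
  have [|c Hc] := IH; first by rewrite uz.
  by exists (widen_ord (leqnSn _) c).
exists ord_max; rewrite /= ltW //=; apply: le_trans zu _.
by rewrite -addrA lerD2l -natr1 mulrDl mul1r.
Qed.

(* Over a cell of the grid of mesh [h] in the other coordinates, [f] stays in an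
   interval of length [2 * L * h]; that interval is itself cut into [M.+1] pieces
   of length [s], so that all coordinates of a box are indexed alike. *)
Lemma lebesgue_null_bounded_graph (f : 'M[R]_(m, n) -> R) (L K : R)
    (i0 : 'I_m) (j0 : 'I_n) :
  0 <= L -> 0 <= K ->
  (forall (x y : 'M[R]_(m, n)) (r : R),
     (forall i j, (i, j) != (i0, j0) -> `|x i j - y i j| <= r) ->
     `|f x - f y| <= L * r) ->
  lebesgue_null [set x : 'M[R]_(m, n) | x i0 j0 = f x /\ forall i j, `|x i j| <= K].
Proof.
move=> L0 K0 lipf.
have m0 : (0 < m)%N by exact: leq_ltn_trans (ltn_ord i0).
have n0 : (0 < n)%N by exact: leq_ltn_trans (ltn_ord j0).
apply: lebesgue_null_finite_cover => // eps eps0.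
pose V := 2 * L * (2 * K) ^+ (m * n).
have V0 : 0 <= V by rewrite !mulr_ge0 ?exprn_ge0 ?mulr_ge0.
pose M := Num.truncn (V / eps).
have VM : V / M.+1%:R <= eps.
  rewrite ler_pdivrMr // mulrC -ler_pdivrMr //; apply: ltW; exact: truncnS_gt.
have M0 : 0 < M.+1%:R :> R by [].
pose h := 2 * K / M.+1%:R.
have h0 : 0 <= h by rewrite divr_ge0 ?mulr_ge0.
pose s := 2 * L * h / M.+1%:R.
have s0 : 0 <= s by rewrite divr_ge0 ?mulr_ge0.
pose T := {ffun 'I_m * 'I_n -> 'I_M.+1}.
pose corner (t : T) : 'M[R]_(m, n) := \matrix_(i, j) (- K + (t (i, j))%:R * h).
pose a (t : T) : 'M[R]_(m, n) := \matrix_(i, j)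
  if (i, j) == (i0, j0) then f (corner t) - L * h + (t (i, j))%:R * s
  else corner t i j.
pose b (t : T) : 'M[R]_(m, n) := \matrix_(i, j)
  (a t i j + if (i, j) == (i0, j0) then s else h).
exists T, a, b; split=> [t i j|x [fx xK]|].
- by rewrite [leRHS]mxE lerDl; case: ifP.
- have /fin_all_exists[c Hc] (p : 'I_m * 'I_n) : exists c : 'I_M.+1,
      - K + c%:R * h <= x p.1 p.2 <= - K + c%:R * h + h.
    apply: grid_cell; have := xK p.1 p.2; rewrite ler_norml => /andP[-> xp] /=.
    rewrite /h mulrC divfK ?lt0r_neq0 //; lra.
  have lipc : `|f x - f (corner [ffun p => c p])| <= L * h.
    apply: lipf => i j _; rewrite mxE ffunE.
    by have := Hc (i, j); rewrite ler_norml /= => /andP[]; lra.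
  have [|c0 Hc0] := @grid_cell (f (corner [ffun p => c p]) - L * h) s (f x) M.
    have -> : M.+1%:R * s = 2 * L * h by rewrite mulrC divfK ?lt0r_neq0.
    by move: lipc; rewrite ler_norml => /andP[]; lra.
  pose t : T := [ffun p => if p == (i0, j0) then c0 else c p].
  have ft : f (corner t) = f (corner [ffun p => c p]).
    apply/eqP; rewrite -subr_eq0 -normr_le0 -(mulr0 L).
    apply: lipf => i j /negPf ij.
    by rewrite !mxE !ffunE ij subrr normr0.
  exists t => // i j; rewrite [b _ _ _]mxE !(mxE, ffunE) ft.
  have [[-> ->]|ij] := eqVneq (i, j) (i0, j0); first by rewrite fx.
  exact: (Hc (i, j)).
rewrite (eq_bigr (fun=> s * h ^+ (m * n).-1)); last first.
  move=> t _; rewrite pair_bigA /= (bigD1 (i0, j0)) //=.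
  rewrite [b _ _ _]mxE eqxx addrAC subrr add0r.
  congr (_ * _).
  rewrite (eq_bigr (fun=> h)) => [|[i j] /negPf ij]; last first.
    by rewrite /= [b _ _ _]mxE ij addrAC subrr add0r.
  rewrite prodr_const; congr (_ ^+ _).
  by rewrite (@eq_card _ _ (predC1 (i0, j0))) // cardC1 card_prod !card_ord.
rewrite sumr_const card_ffun card_prod !card_ord.
apply: le_trans VM; rewrite /V le_eqVlt; apply/orP; left; apply/eqP.
have [P ->] : exists P, (m * n = P.+1)%N.
  by exists (m * n).-1; rewrite prednK ?muln_gt0 ?m0.
have -> : 2 * K = h * M.+1%:R by rewrite /h divfK ?lt0r_neq0.
rewrite -[LHS]mulr_natr natrX /s [(h * _) ^+ _]exprMn !exprS; field.
exact: lt0r_neq0.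
Qed.

Lemma lebesgue_null_graph (f : 'M[R]_(m, n) -> R) (L : R)
    (i0 : 'I_m) (j0 : 'I_n) :
  0 <= L ->
  (forall (x y : 'M[R]_(m, n)) (r : R),
     (forall i j, (i, j) != (i0, j0) -> `|x i j - y i j| <= r) ->
     `|f x - f y| <= L * r) ->
  lebesgue_null [set x : 'M[R]_(m, n) | x i0 j0 = f x].
Proof.
move=> L0 lipf.
have m0 : (0 < m)%N by exact: leq_ltn_trans (ltn_ord i0).
have n0 : (0 < n)%N by exact: leq_ltn_trans (ltn_ord j0).
rewrite (_ : [set _ | _] =
    \bigcup_k [set x : 'M[R]_(m, n) |
      x i0 j0 = f x /\ forall i j, `|x i j| <= k%:R]); last first.
  apply/seteqP; split=> [x fx|x [k _ []] //].
  exists (Num.truncn `|x|).+1 => //; split=> // i j.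
  apply: le_trans (ltW (truncnS_gt _)); rewrite [leRHS]/Num.Def.normr /= mx_normrE.
  exact: (le_bigmax _ (fun p => `|x p.1 p.2|) (i, j)).
apply: lebesgue_null_bigcup => // k.
exact: lebesgue_null_bounded_graph L0 (ler0n _ k) lipf.
Qed.

End NullSets.

(** * Formations *)

Section Formation.
Context {R : realType} {d n : nat}.
Variables (E : rel 'I_n) (g : 'I_n -> 'I_n -> 'cV[R]_d).
Implicit Types p : R -> 'M[R]_(d, n).

Lemma ray_derive_agent p i : formation_solution E g p ->
  ray_derive_col (fun t => col i (p t)) (fun t => control_field E g (p t) i).
Proof.
move=> [cp _ Dp] k; split=> [x|t t0].
  rewrite (_ : (fun t => col i (p t) k 0) = (fun M : 'M[R]_(d, n) => M k i) \o p).
    exact: continuous_comp (cp x) (@coord_continuous _ _ _ k i _).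
  by apply/funext => s /=; rewrite mxE.
have [Dc Ec] := Dp t i t0; have Dk := (derivable_mxP _ _ _).1 Dc k 0.
by apply: DeriveDef => //; rewrite -Ec derive_mx // mxE.
Qed.

Lemma control_fieldE (q : 'M[R]_(d, n)) i : bearings_defined E q ->
  control_field E g q i =
    - \sum_(j < n | E i j) projd (col j q - col i q) (g i j).
Proof.
move=> q0; congr (- _); apply: eq_bigr => j Eij.
by rewrite -proj_orth_mul // subr_eq0 eq_sym q0.
Qed.

Lemma bearingE (q : 'M[R]_(d, n)) i j : col i q != col j q ->
  col j q - col i q = enorm (col j q - col i q) *: bearing q i j.
Proof.
move=> qij; rewrite /bearing scalerA divff ?scale1r //.
by rewrite lt0r_neq0 // enorm_gt0 // subr_eq0 eq_sym.
Qed.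

End Formation.

Lemma exp_decay_cvg (R : realType) (m n : nat) (f : R -> 'M[R]_(m, n)) l :
  exp_decay (fun t => enorm (f t - l)) -> f t @[t --> +oo] --> l.
Proof.
move=> [C [c [C0 c0 fC]]]; apply/cvgrPdist_le => e e0; near=> t.
have t0 : 0 <= t by near: t; exact: nbhs_pinfty_ge.
rewrite distrC; apply: le_trans (mx_norm_le_enorm _) _.
apply: le_trans (fC t t0) _; rewrite mulNr expRN ler_pdivrMr ?expR_gt0 //.
have : C / (e * c) <= t by near: t; apply: nbhs_pinfty_ge; exact: num_real.
rewrite ler_pdivrMr ?mulr_gt0 // => Ct.
have := ler_wpM2l (ltW e0) (expR_ge1Dx (c * t)); lra.
Unshelve. all: by end_near. Qed.

Lemma lebesgue_null_aligned (R : realType) (d n : nat) (h : 'cV[R]_d)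
    (i0 i1 : 'I_n) : (2 <= d)%N -> i0 != i1 -> h != 0 ->
  exists2 N : set 'M[R]_(d, n), lebesgue_null N &
    forall x s, col i0 x - col i1 x = s *: h -> N x.
Proof.
move=> d2 i01 h0.
have [a ha] : exists a, h a 0 != 0.
  apply/existsP; apply: contraNT h0 => /existsPn h0; apply/eqP/matrixP => a j.
  by rewrite ord1 mxE; apply/eqP; have := h0 a; rewrite negbK.
have [b ba] : exists b : 'I_d, b != a.
  have /card_gt0P[b] : (0 < #|predC1 a|)%N.
    by rewrite cardC1 card_ord; case: (d) d2 => [|[]].
  by exists b.
pose r := h b 0 / h a 0.
pose f (x : 'M[R]_(d, n)) := x b i1 + r * (x a i0 - x a i1).
exists [set x : 'M[R]_(d, n) | x b i0 = f x].
  apply: (@lebesgue_null_graph _ _ _ f (1 + 2 * `|r|)) => [|x y e xy].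
    by rewrite addr_ge0 ?mulr_ge0.
  have /= := xy b i1; rewrite xpair_eqE eqxx eq_sym i01 => /(_ isT) e1.
  have /= := xy a i0; rewrite xpair_eqE eq_sym (negPf ba) => /(_ isT) e2.
  have /= := xy a i1; rewrite xpair_eqE eq_sym (negPf ba) => /(_ isT) e3.
  have -> : f x - f y =
      (x b i1 - y b i1) + r * ((x a i0 - y a i0) - (x a i1 - y a i1)).
    by rewrite /f; ring.
  apply: le_trans (ler_normD _ _) _; rewrite mulrDl mul1r lerD // normrM.
  rewrite -mulrA mulrCA ler_wpM2l //; apply: le_trans (ler_normB _ _) _; lra.
move=> x s xs /=; rewrite /f.
have Ek k : x k i0 - x k i1 = s * h k 0.
  by have /matrixP/(_ k 0) := xs; rewrite !mxE.
by rewrite Ek /r mulrCA divfK // -Ek; ring.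
Qed.

Theorem theorem2 (R : realType) (d n : nat) (E : rel 'I_n)
    (g : 'I_n -> 'I_n -> 'cV[R]_d)
    (d_ge2 : (2 <= d)%N)
    (LFF_E : ordered_LFF E)
    (g_unit : forall i j : 'I_n, E i j -> enorm (g i j) = 1)
    (g_real : noncollinear_realizable E g) :
  exists2 N : set 'M[R]_(d, n), lebesgue_null N &
    forall p0 : 'M[R]_(d, n), ~ N p0 ->
    forall p : R -> 'M[R]_(d, n), formation_solution E g p -> p 0 = p0 ->
    exists pinf : 'M[R]_(d, n),
      [/\ bearing_preimage E g pinf,
          p t @[t --> +oo] --> pinf &
          exists C lambda : R, 0 < lambda /\
            forall t : R, 0 <= t ->
              enorm (p t - pinf) <= C * expR (- lambda * t)].
Proof.
case: LFF_E => n1 E0 E1 E2; case: g_real => P [P0 Pg] Pnc.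
pose o0 : 'I_n := Ordinal (ltnW n1); pose o1 : 'I_n := Ordinal n1.
have E10 : E o1 o0 by rewrite E1.
have gdot i j : E i j -> dot (g i j) (g i j) = 1.
  by move=> /g_unit gij; rewrite -enorm_sqr gij expr1n.
have Pe i j : E i j -> col j P - col i P = enorm (col j P - col i P) *: g i j.
  by move=> Eij; rewrite -Pg // -bearingE ?P0.
have Pe0 i j : E i j -> 0 < enorm (col j P - col i P).
  by move=> Eij; rewrite enorm_gt0 // subr_eq0 eq_sym P0.
set h := g o1 o0; have h1 : dot h h = 1 by exact: gdot.
have h0 : h != 0.
  by apply/eqP => h0; move: h1; rewrite h0 -(scale0r h) dotZl mul0r; lra.
have [N N0 Nh] := @lebesgue_null_aligned R d n h o0 o1 d_ge2 isT h0.
exists N => // p0 Np0 p sol p00.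
have [_ pE _] := sol.
pose z t := col o0 (p t) - col o1 (p t).
have z0 t : 0 <= t -> z t != 0 by move=> t0; rewrite subr_eq0 eq_sym pE.
have leader t : 0 <= t -> col o0 (p t) = col o0 p0.
  move=> t0; rewrite -p00; apply/matrixP => k j; rewrite ord1.
  apply: (ray_const (ray_derive_agent o0 sol k)) t0 => s _.
  rewrite /control_field big_pred0 ?oppr0 ?mxE // => i.
  exact/negbTE/E0.
have Dz : ray_derive_col z (fun t => projd (z t) h).
  move=> k; have := ray_derive_colD (ray_derive_agent o0 sol)
    (ray_derive_colN (ray_derive_agent o1 sol)) k.
  move/ray_derive_eq; apply => t t0.
  rewrite {1}/control_field big_pred0 => [|i]; last exact/negbTE/E0.
  rewrite (control_fieldE _ _ (pE t (ltW t0))) (big_pred1 o0) => [|i];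
    last by rewrite E1.
  by rewrite oppr0 add0r opprK.
have zh0 : - enorm (z 0) < dot (z 0) h.
  rewrite ltNge; apply/negP => zh; apply: Np0; apply: (Nh _ (- enorm (z 0))).
  by rewrite -p00; exact: dot_le_Nenorm.
pose s := enorm (z 0) / enorm (col o0 P - col o1 P).
have s0 : 0 < s by rewrite divr_gt0 ?Pe0 // enorm_gt0 // z0.
pose pinf : 'M[R]_(d, n) := \matrix_(k, i) (p0 k o0 + s * (P k i - P k o0)).
have pinfB i j : col j pinf - col i pinf = s *: (col j P - col i P).
  by apply/matrixP => k l; rewrite !mxE; ring.
have decay i : exp_decay (fun t => enorm (col i (p t) - col i pinf)).
  have [m] := ubnP (val i); elim: m i => // m IH i; rewrite ltnS => im.
  have [i0|] := eqVneq (val i) 0%N.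
    have -> : i = o0 by exact: val_inj.
    apply: exp_decay_le exp_decay0 _ => t t0; rewrite leader //.
    rewrite (_ : col o0 p0 - _ = 0 *: h) ?enormZ ?mul0r //.
    by apply/matrixP => k j; rewrite !mxE; ring.
  have [i1 _|i1 i0] := eqVneq (val i) 1%N.
    have -> : i = o1 by exact: val_inj.
    apply: exp_decay_le (first_follower_decay Dz z0 h1 zh0) _ => t t0.
    rewrite -enormN le_eqVlt; apply/orP; left; apply/eqP; congr enorm.
    have -> : enorm (z 0) *: h = col o0 pinf - col o1 pinf.
      by rewrite pinfB (Pe _ _ E10) -/h scalerA /s divfK // gt_eqF ?Pe0.
    rewrite /z leader //; apply/matrixP => k j; rewrite !mxE; ring.
  have i2 : (2 <= i)%N by move: i0 i1 => /=; case: (nat_of_ord i) => [|[]].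
  have [card2 Ei] := E2 i i2.
  have /card_gt1P[j1 [j2 []]] := card2; rewrite !inE => Ej1 Ej2 j12.
  apply: (@follower_decay _ _ _ (E i) _ (fun j t => col j (p t)) (g i)
    (fun j => col j pinf) _ (fun j => s * enorm (col j P - col i P)) j1 j2) => //.
  - move=> k; apply: ray_derive_eq (ray_derive_agent i sol k) _ => t t0.
    by rewrite (control_fieldE _ _ (pE t (ltW t0))).
  - by move=> j t Eij t0; rewrite subr_eq0 eq_sym pE.
  - by move=> j; exact: gdot.
  - by move=> j Eij; rewrite mulr_gt0 ?Pe0.
  - by move=> j Eij; rewrite pinfB -scalerA -Pe.
  - by move=> j Eij; apply: IH; exact: leq_trans (Ei j Eij) im.
  - apply: (@noncollinear_dot_lt1 _ _ (col i P) _ _ (enorm (col j1 P - col i P))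
      (enorm (col j2 P - col i P))); rewrite ?gdot //.
    by rewrite -!Pe // ![col i P + _]addrC !subrK; exact: Pnc.
have conv : exp_decay (fun t => enorm (p t - pinf)).
  apply: exp_decay_sqrt => [t _|]; first exact: enorm_ge0.
  apply: exp_decay_le (exp_decay_sum (P := xpredT) (fun i _ =>
    exp_decay_sqr (fun t _ => enorm_ge0 _) (decay i))) _ => t t0.
  by rewrite enorm_sqr_col; under eq_bigr do rewrite linearB.
exists pinf; split; last by have [C [l [_ l0 H]]] := conv; exists C, l.
- split=> [i j Eij|i j Eij].
    by rewrite -subr_eq0 pinfB scaler_eq0 gt_eqF //= subr_eq0 P0.
  rewrite -Pg // /bearing pinfB enormZ ?ltW // scalerA invfM mulrAC.
  by rewrite mulVf ?gt_eqF // mul1r.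
- exact: exp_decay_cvg.
Qed.
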